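(* Let $n\ge 3$ and let $N_1,N_2\ge 0$ be integers. Then the degree-zero cohomology of the Koszul complex $C_{-N_1}^{N_2}(n)$ is equal to the algebra $AQ_{-N_1}^{N_2}(n)$, and all other cohomology of $C_{-N_1}^{N_2}(n)$ vanishes.
   Context: Fix integers $N_1,N_2\ge 0$ and $n$. Consider the polynomial ring $\mathbb{C}[\lambda^i[s]]$ in the commuting variables $\lambda^i[s]$, $1\le i\le n$, $-N_1\le s\le N_2$. For $-2N_1\le k\le 2N_2$ put $$f[k]=\sum_{s+t=k}\ \sum_{i=1}^n\lambda^i[s]\lambda^i[t],$$ where $s,t$ range over $-N_1\le s,t\le N_2$. (These are the coefficients of $\sum_i(\lambda^i(z))^2$ for $\lambda^i(z)=\sum_{-N_1\le s\le N_2}\lambda^i[s]z^s$.) The algebra $AQ_{-N_1}^{N_2}(n)$ is the quotient $\mathbb{C}[\lambda^i[s]]/(f[-2N_1],\dots,f[2N_2])$. The Koszul complex is $C_{-N_1}^{N_2}(n)=\mathbb{C}[\lambda^i[s]]\otimes\Lambda[c[k]]$, where $\Lambda[c[k]]$ is the exterior algebra on odd generators $c[k]$, $-2N_1\le k\le 2N_2$, with differential $\sum_{k=-2N_1}^{2N_2} f[k]\,\frac{\partial}{\partial c[k]}$. It is graded by the degree in the variables $c[k]$ (each $c[k]$ has degree one, each $\lambda^i[s]$ has degree zero). *)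

(* Defs.v *)
From HB Require Import structures.
From mathcomp Require Import all_boot all_order all_algebra.
From mathcomp Require Import ring_quotient generic_quotient.
From mathcomp Require Import boolp reals complex mpoly ring.

Set Implicit Arguments.
Unset Strict Implicit.
Unset Printing Implicit Defensive.

Import GRing.Theory.
Local Open Scope ring_scope.
Local Open Scope quotient_scope.

Section ExteriorSign.

Variables (A : comNzRingType) (M : nat).
Implicit Types S T W : {set 'I_M}.

(* The scalar with c_S c_T = ext_sign S T * c_(S :|: T), where c_S is the
   increasing product of the c_k, k in S. It vanishes when S meets T. *)
Definition ext_sign S T : A :=
  \prod_(i in S) \prod_(j in T)
    (if (i < j)%N then 1 else if (j < i)%N then -1 else 0).

Let prod_setU S T (F : 'I_M -> A) : [disjoint S & T] ->
  \prod_(i in S :|: T) F i = \prod_(i in S) F i * \prod_(i in T) F i.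
Proof. by move=> ST; rewrite -bigU //; apply: eq_bigl => i; rewrite !inE. Qed.

Lemma ext_sign0s S : ext_sign set0 S = 1.
Proof. by rewrite /ext_sign big_set0. Qed.

Lemma ext_signs0 S : ext_sign S set0 = 1.
Proof. by rewrite /ext_sign big1 // => i _; rewrite big_set0. Qed.

Lemma ext_signUl S T W :
  [disjoint S & T] -> ext_sign (S :|: T) W = ext_sign S W * ext_sign T W.
Proof. by move=> ST; rewrite /ext_sign prod_setU. Qed.

Lemma ext_signUr S T W :
  [disjoint T & W] -> ext_sign S (T :|: W) = ext_sign S T * ext_sign S W.
Proof.
move=> TW; rewrite /ext_sign -big_split /=.
by apply: eq_bigr => i _; rewrite prod_setU.
Qed.

Lemma ext_sign_meet k S T : k \in S -> k \in T -> ext_sign S T = 0.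
Proof.
move=> kS kT.
by rewrite /ext_sign (bigD1 k) //= (bigD1 k kT) /= ltnn !mul0r.
Qed.

Lemma ext_sign_disj S T : ~~ [disjoint S & T] -> ext_sign S T = 0.
Proof.
by rewrite -setI_eq0 => /set0Pn[k /setIP[kS kT]]; apply: ext_sign_meet kS kT.
Qed.

Lemma ext_signA S T W :
  ext_sign S T * ext_sign (S :|: T) W = ext_sign T W * ext_sign S (T :|: W).
Proof.
have [ST|/ext_sign_disj ST] := boolP [disjoint S & T]; last first.
  rewrite ST mul0r; have [TW|/ext_sign_disj->] := boolP [disjoint T & W].
    by rewrite (ext_signUr _ TW) ST mul0r mulr0.
  by rewrite mul0r.
rewrite (ext_signUl _ ST).
have [TW|/ext_sign_disj->] := boolP [disjoint T & W].
  by rewrite (ext_signUr _ TW); ring.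
by rewrite mulr0 !mul0r mulr0.
Qed.

Lemma ext_sign_sqr k S : k \notin S ->
  ext_sign [set k] S * ext_sign [set k] S = 1.
Proof.
move=> kS; rewrite /ext_sign !big_set1 -big_split big1 //= => j jS.
case: ltngtP => [||/val_inj kj]; rewrite ?mulr1 ?mulrNN ?mulr1 //.
by rewrite kj jS in kS.
Qed.

Lemma ext_sign_swap k S : k \notin S ->
  ext_sign [set k] S * ext_sign S [set k] = (-1) ^+ #|S|.
Proof.
move=> kS; rewrite /ext_sign big_set1 -big_split -prodr_const /=.
apply: eq_bigr => j jS; rewrite big_set1.
case: ltngtP => [||/val_inj kj]; rewrite ?mulr1 ?mul1r //.
by rewrite kj jS in kS.
Qed.

End ExteriorSign.

Arguments ext_signUl {A M S T}.
Arguments ext_signUr {A M} S {T W}.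
Arguments ext_sign_meet {A M k S T}.
Arguments ext_sign_disj {A M S T}.
Arguments ext_sign_sqr {A M k S}.
Arguments ext_sign_swap {A M k S}.

(* The exterior algebra over A on generators c_k, k < M, as the free A-module
   on the monomials c_S: x : extalg A M stands for \sum_S x S * c_S. For A a
   polynomial ring C[lambda] this is C[lambda] (x) Lambda[c]. *)
Definition extalg (A : comNzRingType) (M : nat) := {ffun {set 'I_M} -> A}.

HB.instance Definition _ A M := GRing.Zmodule.on (extalg A M).

Section ExteriorAlgebra.

Variables (A : comNzRingType) (M : nat).
Local Notation E := (extalg A M).
Local Notation sg := (@ext_sign A M).
Implicit Types (x y z : E) (S T U : {set 'I_M}) (a : A) (k : 'I_M).

Definition ext_mon S : E := [ffun T => (T == S)%:R].

Definition ext_gen k : E := ext_mon [set k].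

Definition ext_mul x y : E :=
  [ffun U => \sum_S \sum_(T | S :|: T == U) sg S T * x S * y T].

Lemma extE x y S : (x + y) S = x S + y S. Proof. by rewrite ffunE. Qed.

Definition ext_scale a x : E := [ffun S => a * x S].

Lemma ext_scaleA a b x : ext_scale a (ext_scale b x) = ext_scale (a * b) x.
Proof. by apply/ffunP => S; rewrite !ffunE mulrA. Qed.

Lemma ext_scale1 : left_id 1 ext_scale.
Proof. by move=> x; apply/ffunP => S; rewrite ffunE mul1r. Qed.

Lemma ext_scaleDr : right_distributive ext_scale +%R.
Proof. by move=> a x y; apply/ffunP => S; rewrite !ffunE mulrDr. Qed.

Lemma ext_scaleDl x : {morph ext_scale^~ x : a b / a + b}.
Proof. by move=> a b; apply/ffunP => S; rewrite !ffunE mulrDl. Qed.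

HB.instance Definition _ := GRing.Zmodule_isLmodule.Build A E
  ext_scaleA ext_scale1 ext_scaleDr ext_scaleDl.

Lemma extZE a x S : (a *: x) S = a * x S. Proof. by rewrite ffunE. Qed.

Lemma ext_sumE I (r : seq I) (P : pred I) (F : I -> E) S :
  (\sum_(i <- r | P i) F i) S = \sum_(i <- r | P i) F i S.
Proof.
elim/big_rec2: _ => [|i y x _ <-]; first by rewrite ffunE.
by rewrite extE.
Qed.

Lemma ext_decomp x : x = \sum_S x S *: ext_mon S.
Proof.
apply/ffunP => U; rewrite ext_sumE (bigD1 U) //= big1 ?addr0.
  by rewrite extZE ffunE eqxx mulr1.
by move=> S SU; rewrite extZE ffunE eq_sym (negPf SU) mulr0.
Qed.

Let reindexU (P : pred {set 'I_M}) (F : forall V T W : {set 'I_M}, A) :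
  \sum_(V | P V) \sum_T \sum_(W | T :|: W == V) F V T W =
  \sum_T \sum_(W | P (T :|: W)) F (T :|: W) T W.
Proof.
rewrite exchange_big; apply: eq_bigr => T _ /=.
rewrite [RHS](partition_big (fun W => T :|: W) P) //=.
apply: eq_bigr => V PV; apply: eq_big => W.
  by case: eqP => [->|]; rewrite ?PV ?andbF.
by move=> /eqP->.
Qed.

Lemma ext_mulA : associative ext_mul.
Proof.
move=> x y z; apply/ffunP => U; rewrite !ffunE.
pose F S T W := sg S T * sg (S :|: T) W * x S * y T * z W.
transitivity (\sum_S \sum_T \sum_(W | S :|: T :|: W == U) F S T W).
  apply: eq_bigr => S _.
  transitivity (\sum_(V | S :|: V == U) \sum_T \sum_(W | T :|: W == V)
       sg S V * x S * (sg T W * y T * z W)).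
    apply: eq_bigr => V _; rewrite ffunE mulr_sumr; apply: eq_bigr => T _.
    by rewrite mulr_sumr.
  rewrite reindexU; apply: eq_bigr => T _; apply: eq_big => W.
    by rewrite setUA.
  rewrite /F ext_signA => _.
  by rewrite [sg T W * sg _ _]mulrC !mulrA; congr (_ * _ * _); rewrite mulrAC.
symmetry.
transitivity (\sum_V \sum_S \sum_(T | S :|: T == V) \sum_(W | V :|: W == U)
       sg V W * (sg S T * x S * y T) * z W).
  apply: eq_bigr => V _; under eq_bigr do rewrite ffunE mulr_sumr mulr_suml.
  rewrite exchange_big; apply: eq_bigr => S _ /=.
  under eq_bigr do rewrite mulr_sumr mulr_suml.
  by rewrite exchange_big.
rewrite reindexU; apply: eq_bigr => S _; apply: eq_bigr => T _.
apply: eq_bigr => W _; rewrite /F [sg S T * sg _ _]mulrC.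
by rewrite !mulrA.
Qed.

Lemma ext_mulDl : left_distributive ext_mul +%R.
Proof.
move=> x y z; apply/ffunP => U; rewrite extE !ffunE -big_split /=.
apply: eq_bigr => S _; rewrite -big_split /=; apply: eq_bigr => T _.
by rewrite extE mulrDr mulrDl.
Qed.

Lemma ext_mulDr : right_distributive ext_mul +%R.
Proof.
move=> x y z; apply/ffunP => U; rewrite extE !ffunE -big_split /=.
apply: eq_bigr => S _; rewrite -big_split /=; apply: eq_bigr => T _.
by rewrite extE mulrDr.
Qed.

Lemma ext_mulZl a x y : a *: ext_mul x y = ext_mul (a *: x) y.
Proof.
apply/ffunP => U; rewrite extZE !ffunE mulr_sumr; apply: eq_bigr => S _.
rewrite mulr_sumr; apply: eq_bigr => T _.
by rewrite extZE !mulrA; congr (_ * _ * _); rewrite mulrC.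
Qed.

Lemma ext_mulZr a x y : a *: ext_mul x y = ext_mul x (a *: y).
Proof.
apply/ffunP => U; rewrite extZE !ffunE mulr_sumr; apply: eq_bigr => S _.
rewrite mulr_sumr; apply: eq_bigr => T _.
by rewrite extZE [RHS]mulrCA.
Qed.

Lemma ext_mul1l : left_id (ext_mon set0) ext_mul.
Proof.
move=> x; apply/ffunP => U; rewrite ffunE (bigD1 set0) //= [X in _ + X]big1.
  rewrite (big_pred1 U) => [|T /=]; last by rewrite set0U.
  by rewrite ffunE eqxx ext_sign0s !mul1r addr0.
move=> S /negPf S0; rewrite big1 // => T _.
by rewrite ffunE S0 mulr0 mul0r.
Qed.

Lemma ext_mul1r : right_id (ext_mon set0) ext_mul.
Proof.
move=> x; apply/ffunP => U; rewrite ffunE (bigD1 U) //= [X in _ + X]big1.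
  rewrite (bigD1 set0) ?setU0 //= big1 => [|T /andP[_ /negPf T0]].
    by rewrite ffunE eqxx ext_signs0 mulr1 mul1r !addr0.
  by rewrite ffunE T0 mulr0.
move=> S SU; rewrite big1 // => T /eqP STU; rewrite ffunE.
have [T0|] := eqVneq T set0; last by rewrite mulr0.
by rewrite -STU T0 setU0 eqxx in SU.
Qed.

Lemma ext_1neq0 : ext_mon set0 != 0 :> E.
Proof.
by apply/eqP => /ffunP/(_ set0)/eqP; rewrite !ffunE eqxx oner_eq0.
Qed.

HB.instance Definition _ := GRing.Zmodule_isNzRing.Build E
  ext_mulA ext_mul1l ext_mul1r ext_mulDl ext_mulDr ext_1neq0.
HB.instance Definition _ := GRing.Lmodule_isLalgebra.Build A E ext_mulZl.
HB.instance Definition _ := GRing.Lalgebra_isAlgebra.Build A E ext_mulZr.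

Lemma ext1E : 1 = ext_mon set0 :> E. Proof. by []. Qed.

Lemma ext_monM S T : ext_mon S * ext_mon T = sg S T *: ext_mon (S :|: T).
Proof.
apply/ffunP => U; rewrite extZE !ffunE (bigD1 S) //= [X in _ + X]big1.
  rewrite addr0; have [->|UST] := eqVneq U (S :|: T).
    rewrite (bigD1 T) //= big1 => [|W /andP[_ /negPf WT]].
      by rewrite !ffunE !eqxx !mulr1 addr0.
    by rewrite !ffunE WT mulr0.
  rewrite big1 ?mulr0 // => W /eqP SWU; rewrite !ffunE.
  have [WT|] := eqVneq W T; last by rewrite mulr0.
  by rewrite -SWU WT eqxx in UST.
move=> W /negPf WS; rewrite big1 // => W' _.
by rewrite ffunE WS mulr0 mul0r.
Qed.

Lemma ext_gen_sqr k : ext_gen k * ext_gen k = 0.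
Proof. by rewrite ext_monM (@ext_sign_meet _ _ k _ _) ?scale0r ?set11. Qed.

Lemma ext_gen_anticomm k l : ext_gen k * ext_gen l = - (ext_gen l * ext_gen k).
Proof.
have [->|kl] := eqVneq k l; first by rewrite ext_gen_sqr oppr0.
rewrite !ext_monM setUC -scaleNr; congr (_ *: _).
rewrite /ext_sign !big_set1; case: ltngtP; rewrite ?opprK //.
by move/val_inj/eqP; rewrite (negPf kl).
Qed.

(* The left derivative d/dc_k: c_k c_S |-> c_S for k \notin S, while monomials
   without c_k go to 0. *)
Definition ext_deriv k x : E := [ffun S => sg [set k] S * x (k |: S)].

Lemma ext_derivE k x S : ext_deriv k x S = sg [set k] S * x (k |: S).
Proof. by rewrite ffunE. Qed.

Lemma ext_deriv_linear k : linear (ext_deriv k).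
Proof.
move=> a x y; apply/ffunP => S.
by rewrite extE extZE !ext_derivE extE extZE mulrDr mulrCA.
Qed.

HB.instance Definition _ k :=
  GRing.isLinear.Build A E E _ (ext_deriv k) (ext_deriv_linear k).

Lemma ext_deriv_mon k S :
  ext_deriv k (ext_mon S) =
  if k \in S then sg [set k] (S :\ k) *: ext_mon (S :\ k) else 0.
Proof.
apply/ffunP => U; rewrite ext_derivE ffunE.
case: ifPn => kS; last first.
  rewrite ffunE; case: eqP => [US|]; last by rewrite mulr0.
  by rewrite -US setU11 in kS.
rewrite extZE ffunE; have [kU|kU] := boolP (k \in U).
  rewrite (@ext_sign_meet _ _ k _ _) ?set11 // mul0r.
  by case: eqP kU => [->|]; rewrite ?mulr0 // !inE eqxx.
have -> : (k |: U == S) = (U == S :\ k).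
  by apply/eqP/eqP => [<-|->]; [rewrite setU1K | rewrite setD1K].
by case: eqP => [->|]; rewrite ?mulr0.
Qed.

(* The grading automorphism, (-1)^j in degree j, appearing in the graded
   Leibniz rule. *)
Definition ext_invol x : E := [ffun S : {set 'I_M} => (-1) ^+ #|S| * x S].

Lemma ext_involE x S : ext_invol x S = (-1) ^+ #|S| * x S.
Proof. by rewrite ffunE. Qed.

Lemma ext_invol_linear : linear ext_invol.
Proof.
move=> a x y; apply/ffunP => S.
by rewrite extE extZE !ext_involE extE extZE mulrDr mulrCA.
Qed.

HB.instance Definition _ :=
  GRing.isLinear.Build A E E _ ext_invol ext_invol_linear.

Lemma ext_invol_mon S : ext_invol (ext_mon S) = (-1) ^+ #|S| *: ext_mon S.
Proof.
apply/ffunP => U; rewrite ffunE extZE ffunE.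
by case: eqP => [->|]; rewrite ?mulr0.
Qed.

Lemma ext_invol_deriv k x :
  ext_deriv k (ext_invol x) = - ext_invol (ext_deriv k x).
Proof.
apply/ffunP => U; rewrite ext_derivE ext_involE [RHS]ffunE ext_involE ext_derivE.
have [kU|kU] := boolP (k \in U).
  by rewrite (@ext_sign_meet _ _ k _ _) ?set11 // !mul0r mulr0 oppr0.
by rewrite cardsU1 kU exprS mulN1r mulNr mulrN mulrCA.
Qed.

Lemma ext_deriv_monM k S T :
  ext_deriv k (ext_mon S * ext_mon T) =
  ext_deriv k (ext_mon S) * ext_mon T
  + ext_invol (ext_mon S) * ext_deriv k (ext_mon T).
Proof.
rewrite ext_monM linearZ /= !ext_deriv_mon ext_invol_mon inE.
have dS X : [disjoint [set k] & X :\ k].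
  by rewrite disjoints1 !inE eqxx.
have [kS|kS] := boolP (k \in S); have [kT|kT] := boolP (k \in T) => /=.
- rewrite (ext_sign_meet kS kT) scale0r.
  rewrite -!scalerAl -!scalerAr !ext_monM !scalerA.
  have -> : S :|: (T :\ k) = S :|: T.
    by apply/setP => u; rewrite !inE; case: eqP => // ->; rewrite kS.
  have -> : (S :\ k) :|: T = S :|: T.
    by apply/setP => u; rewrite !inE; case: eqP => // ->; rewrite kT !orbT.
  rewrite -scalerDl -[LHS](scale0r (ext_mon (S :|: T))); congr (_ *: _).
  have -> : sg (S :\ k) T = sg (S :\ k) [set k] * sg (S :\ k) (T :\ k).
    by rewrite -{1}(setD1K kT) (ext_signUr _ (dS T)).
  have -> : sg S (T :\ k) = sg [set k] (T :\ k) * sg (S :\ k) (T :\ k).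
    by rewrite -{1}(setD1K kS) (ext_signUl _ (dS S)).
  rewrite mulrA ext_sign_swap ?inE ?eqxx //.
  rewrite [X in _ + X](_ : _ = (-1) ^+ #|S| * sg (S :\ k) (T :\ k)).
    by rewrite (cardsD1 k S) kS exprS mulN1r mulNr subrr.
  by rewrite -[RHS]mulr1 -(@ext_sign_sqr _ _ k (T :\ k)) ?inE ?eqxx //; ring.
- rewrite mulr0 addr0 -!scalerAl ext_monM !scalerA.
  have -> : (S :|: T) :\ k = (S :\ k) :|: T.
    by rewrite setDUl [T :\ k](setDidPl _) // disjoint_sym disjoints1.
  congr (_ *: _); rewrite -{1}(setD1K kS) (ext_signUl _ (dS S)).
  have [dST|dST] := boolP [disjoint (S :\ k) & T].
    by rewrite (ext_signUr _ dST) -[RHS]mul1r -(ext_sign_sqr kT); ring.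
  by rewrite (ext_sign_disj dST) !(mulr0, mul0r).
- rewrite mul0r add0r -!scalerAl -!scalerAr ext_monM !scalerA.
  have -> : (S :|: T) :\ k = S :|: (T :\ k).
    by rewrite setDUl [S :\ k](setDidPl _) // disjoint_sym disjoints1.
  congr (_ *: _); rewrite -{1}(setD1K kT) (ext_signUr _ (dS T)).
  have [dST|dST] := boolP [disjoint S & (T :\ k)].
    rewrite (ext_signUr _ dST) -(ext_sign_swap kS).
    by ring.
  by rewrite (ext_sign_disj dST) !(mulr0, mul0r).
- by rewrite mul0r mulr0 addr0 scaler0.
Qed.

End ExteriorAlgebra.

Section Koszul.

Variables (A : comNzRingType) (M : nat) (f : 'I_M -> A).
Local Notation E := (extalg A M).
Implicit Types (x y : E) (a : A) (S : {set 'I_M}) (k : 'I_M).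

(* x is homogeneous of degree j in the c_k; 0 has every degree. *)
Definition ext_homog (j : nat) x := forall S, x S != 0 -> #|S| = j.

Definition koszul_diff x : E := \sum_(k < M) f k *: ext_deriv k x.

Lemma koszul_diff_linear : linear koszul_diff.
Proof.
move=> a x y; rewrite /koszul_diff scaler_sumr -big_split /=.
by apply: eq_bigr => k _; rewrite linearP scalerDr !scalerA mulrC.
Qed.

HB.instance Definition _ :=
  GRing.isLinear.Build A E E _ koszul_diff koszul_diff_linear.

Lemma ext_deriv_Leibniz k x y :
  ext_deriv k (x * y) = ext_deriv k x * y + ext_invol x * ext_deriv k y.
Proof.
rewrite {1 2 3}(ext_decomp x) !(mulr_suml, linear_sum) /= -big_split /=.
apply: eq_bigr => S _; rewrite !linearZ /= -!scalerAl !linearZ -scalerDr /=.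
congr (_ *: _).
rewrite {1 2 3}(ext_decomp y) !(mulr_sumr, linear_sum) /= -big_split /=.
apply: eq_bigr => T _; rewrite !linearZ /= -!scalerAr !linearZ -scalerDr /=.
by rewrite ext_deriv_monM.
Qed.

Lemma koszul_diff_Leibniz x y :
  koszul_diff (x * y) = koszul_diff x * y + ext_invol x * koszul_diff y.
Proof.
rewrite /koszul_diff mulr_suml mulr_sumr -big_split /=.
apply: eq_bigr => k _.
by rewrite ext_deriv_Leibniz scalerDr scalerAl scalerAr.
Qed.

Lemma ext_involK x : ext_invol (ext_invol x) = x.
Proof.
by apply/ffunP => S; rewrite !ext_involE mulrA -expr2 sqrr_sign mul1r.
Qed.

Lemma koszul_diff_invol x :
  koszul_diff (ext_invol x) = - ext_invol (koszul_diff x).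
Proof.
rewrite /koszul_diff linear_sum -sumrN; apply: eq_bigr => k _.
by rewrite ext_invol_deriv linearZ scalerN.
Qed.

Lemma koszul_diff1 : koszul_diff 1 = 0.
Proof.
rewrite /koszul_diff big1 // => k _.
by rewrite ext1E ext_deriv_mon inE scaler0.
Qed.

Lemma koszul_diff_gen k : koszul_diff (ext_gen A k) = (f k)%:A.
Proof.
rewrite /koszul_diff (bigD1 k) //= big1 => [|l lk].
  by rewrite addr0 ext_deriv_mon set11 setDv ext_signs0 scale1r.
by rewrite ext_deriv_mon inE (negPf lk) scaler0.
Qed.

Lemma koszul_diffK x : koszul_diff (koszul_diff x) = 0.
Proof.
have dM y z : koszul_diff (koszul_diff (y * z)) =
    koszul_diff (koszul_diff y) * z + y * koszul_diff (koszul_diff z).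
  rewrite koszul_diff_Leibniz linearD /= !koszul_diff_Leibniz ext_involK.
  by rewrite koszul_diff_invol mulNr addrA addrK.
suff dmon S : koszul_diff (koszul_diff (ext_mon A S)) = 0.
  rewrite [x]ext_decomp [X in koszul_diff X](linear_sum koszul_diff) /=.
  rewrite (linear_sum koszul_diff) /=.
  by apply: big1 => S _; rewrite linearZ /= linearZ /= dmon scaler0.
have [m] := ubnP #|S|; elim: m S => // m IHm S.
have [->|/set0Pn[k kS]] := eqVneq S set0.
  by rewrite -ext1E koszul_diff1 linear0.
rewrite ltnS (cardsD1 k S) kS add1n => /IHm dS.
have kS' : k \notin S :\ k by rewrite !inE eqxx.
have -> : ext_mon A S =
    ext_sign A [set k] (S :\ k) *: (ext_gen A k * ext_mon A (S :\ k)).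
  by rewrite ext_monM scalerA ext_sign_sqr // scale1r setD1K.
rewrite !linearZ /= dM dS koszul_diff_gen linearZ /= koszul_diff1.
by rewrite scaler0 mul0r mulr0 addr0 scaler0.
Qed.

Definition koszul_closed : {pred E} := [pred x | koszul_diff x == 0].

Lemma koszul_closed_subalg : GRing.subalg_closed koszul_closed.
Proof.
split=> [|a x y|x y]; rewrite !inE; first by rewrite koszul_diff1.
  by move=> /eqP dx /eqP dy; rewrite linearP /= dx dy scaler0 addr0.
move=> /eqP dx /eqP dy.
by rewrite koszul_diff_Leibniz dx dy mul0r mulr0 addr0.
Qed.

HB.instance Definition _ :=
  GRing.isSubalgClosed.Build A E koszul_closed koszul_closed_subalg.

Record koszul_cocycle := KoszulCocycle {
  cocycle_val :> E;
  _ : cocycle_val \in koszul_closed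
}.

HB.instance Definition _ := [isSub for cocycle_val].
HB.instance Definition _ := [Choice of koszul_cocycle by <:].
HB.instance Definition _ :=
  [SubChoice_isSubAlgebra of koszul_cocycle by <:].

Lemma koszul_cocycleP (z : koszul_cocycle) : koszul_diff (val z) = 0.
Proof. exact/eqP/(valP z). Qed.

Definition koszul_exact : {pred koszul_cocycle} :=
  [pred z | `[< exists y : E, val z = koszul_diff y >]].

Lemma koszul_exactP (z : koszul_cocycle) :
  reflect (exists y : E, val z = koszul_diff y) (z \in koszul_exact).
Proof. exact: asboolP. Qed.

Lemma koszul_exact_zmod : zmod_closed koszul_exact.
Proof.
split=> [|z w]; first by apply/koszul_exactP; exists 0; rewrite !linear0.
move=> /koszul_exactP[x zx] /koszul_exactP[y wy]; apply/koszul_exactP.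
by exists (x - y); rewrite !linearB /= zx wy.
Qed.

HB.instance Definition _ :=
  GRing.isZmodClosed.Build koszul_cocycle koszul_exact koszul_exact_zmod.

Lemma koszul_exactMl (z w : koszul_cocycle) :
  w \in koszul_exact -> z * w \in koszul_exact.
Proof.
move=> /koszul_exactP[y wy]; apply/koszul_exactP; exists (ext_invol (val z) * y).
rewrite koszul_diff_Leibniz koszul_diff_invol koszul_cocycleP linear0 oppr0.
by rewrite mul0r add0r ext_involK rmorphM /= wy.
Qed.

Lemma koszul_exactMr (z w : koszul_cocycle) :
  z \in koszul_exact -> z * w \in koszul_exact.
Proof.
move=> /koszul_exactP[y zy]; apply/koszul_exactP; exists (y * val w).
by rewrite koszul_diff_Leibniz koszul_cocycleP mulr0 addr0 rmorphM /= zy.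
Qed.

(* Total cohomology: cocycles modulo koszul_diff-exact ones, an algebra for the
   exterior product, with the degree j summand cohomology_part j below. *)
Definition koszul_cohomology := {ideal_quot koszul_exact}.

HB.instance Definition _ := GRing.Zmodule.on koszul_cohomology.

Definition cohomology_class (z : koszul_cocycle) : koszul_cohomology :=
  \pi_{ideal_quot koszul_exact} z.

Local Notation cls := cohomology_class.

Lemma cohomology_classP z w : reflect (cls z = cls w) (z - w \in koszul_exact).
Proof. by rewrite Quotient.idealrBE; apply: eqP. Qed.

Lemma cohomology_class_surj h : exists z, h = cls z.
Proof. by exists (repr (h : {ideal_quot koszul_exact})); rewrite /cls reprK. Qed.

Lemma cohomology_class_is_zmod_morphism : zmod_morphism cls.
Proof. by move=> z w; rewrite [LHS]raddfB. Qed.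

HB.instance Definition _ := GRing.isZmodMorphism.Build
  koszul_cocycle koszul_cohomology cls cohomology_class_is_zmod_morphism.

Definition cohomology_mul (h h' : koszul_cohomology) : koszul_cohomology :=
  cls (repr (h : {ideal_quot koszul_exact})
       * repr (h' : {ideal_quot koszul_exact})).

Lemma cohomology_classM z w : cls (z * w) = cohomology_mul (cls z) (cls w).
Proof.
have clsK u : cls (repr (cls u : {ideal_quot koszul_exact})) = cls u.
  by rewrite [LHS]/cls reprK.
apply/cohomology_classP.
set z' := repr _; set w' := repr _.
rewrite -(subrK (z * w') (z * w)) -addrA -mulrBr -mulrBl rpredD //.
  by apply: koszul_exactMl; apply/cohomology_classP; rewrite clsK.
by apply: koszul_exactMr; apply/cohomology_classP; rewrite clsK.
Qed.

Ltac cls_intro h := have [? ->] := cohomology_class_surj h.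

Lemma cohomology_mulA : associative cohomology_mul.
Proof.
move=> h1 h2 h3; cls_intro h1; cls_intro h2; cls_intro h3.
by rewrite -!cohomology_classM mulrA.
Qed.

Lemma cohomology_mul1l : left_id (cls 1) cohomology_mul.
Proof. by move=> h; cls_intro h; rewrite -cohomology_classM mul1r. Qed.

Lemma cohomology_mul1r : right_id (cls 1) cohomology_mul.
Proof. by move=> h; cls_intro h; rewrite -cohomology_classM mulr1. Qed.

Lemma cohomology_mulDl : left_distributive cohomology_mul +%R.
Proof.
move=> h1 h2 h3; cls_intro h1; cls_intro h2; cls_intro h3.
by rewrite -raddfD -!cohomology_classM mulrDl raddfD.
Qed.

Lemma cohomology_mulDr : right_distributive cohomology_mul +%R.
Proof.
move=> h1 h2 h3; cls_intro h1; cls_intro h2; cls_intro h3.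
by rewrite -raddfD -!cohomology_classM mulrDr raddfD.
Qed.

HB.instance Definition _ := GRing.Zmodule_isPzRing.Build koszul_cohomology
  cohomology_mulA cohomology_mul1l cohomology_mul1r
  cohomology_mulDl cohomology_mulDr.

Lemma cohomology_class_is_monoid_morphism : monoid_morphism cls.
Proof. by split=> // z w; rewrite cohomology_classM. Qed.

HB.instance Definition _ := GRing.isMonoidMorphism.Build
  koszul_cocycle koszul_cohomology cls cohomology_class_is_monoid_morphism.

Definition cohomology_scale a (h : koszul_cohomology) := cls a%:A * h.

Lemma cohomology_scaleA a b h :
  cohomology_scale a (cohomology_scale b h) = cohomology_scale (a * b) h.
Proof.
by rewrite /cohomology_scale mulrA -rmorphM -scalerAl mul1r scalerA.
Qed.

Lemma cohomology_scale1 : left_id 1 cohomology_scale.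
Proof. by move=> h; rewrite /cohomology_scale scale1r rmorph1 mul1r. Qed.

Lemma cohomology_scaleDr : right_distributive cohomology_scale +%R.
Proof. by move=> a h h'; rewrite /cohomology_scale mulrDr. Qed.

Lemma cohomology_scaleDl h : {morph cohomology_scale^~ h : a b / a + b}.
Proof. by move=> a b; rewrite /cohomology_scale scalerDl rmorphD mulrDl. Qed.

HB.instance Definition _ := GRing.Zmodule_isLmodule.Build A koszul_cohomology
  cohomology_scaleA cohomology_scale1 cohomology_scaleDr cohomology_scaleDl.

Lemma cohomology_classZ : scalable cls.
Proof.
move=> a z; rewrite -[LHS]/(cls _) -[RHS]/(cls a%:A * cls z).
by rewrite -rmorphM -scalerAl mul1r.
Qed.

HB.instance Definition _ := GRing.isScalable.Build
  A koszul_cocycle koszul_cohomology _ cls cohomology_classZ.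

Definition cohomology_part (j : nat) (h : koszul_cohomology) : Prop :=
  exists2 z : koszul_cocycle, ext_homog j (val z) & h = cls z.

Definition gen_ideal : {pred A} :=
  [pred a | `[< exists g : 'I_M -> A, a = \sum_(k < M) g k * f k >]].

Lemma gen_ideal_closed : 1 \notin gen_ideal -> idealr_closed gen_ideal.
Proof.
move=> nI1; split=> // [|a u v /asboolP[g ->] /asboolP[h ->]]; apply/asboolP.
  by exists (fun=> 0); rewrite big1 // => k _; rewrite mul0r.
exists (fun k => a * g k + h k); rewrite mulr_sumr -big_split /=.
by apply: eq_bigr => k _; rewrite mulrDl mulrA.
Qed.

Lemma cohomology_1neq0 : 1 \notin gen_ideal -> 1 != 0 :> koszul_cohomology.
Proof.
apply: contraNneq => h10.
have /cohomology_classP/koszul_exactP[y] : cls 1 = cls 0.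
  by rewrite raddf0 -h10 rmorph1.
rewrite subr0 rmorph1 => /ffunP/(_ set0); rewrite ext1E ffunE eqxx => dy.
apply/asboolP; exists (fun k => ext_deriv k y set0).
rewrite [LHS]dy ext_sumE; apply: eq_bigr => k _.
by rewrite extZE mulrC.
Qed.

End Koszul.

Arguments cohomology_class {A M f}.
Arguments cohomology_part {A M f}.

(* A mode s with -a <= s <= b is encoded by the ordinal s + a. *)
Definition mode (a b : nat) (s : 'I_(a + b).+1) : int := s%:Z - a%:Z.

(* C[lambda^i[s]]; the pair (i, s) is turned into a variable index by
   enum_rank, and C is R[i]. *)
Notation lambda_ring R n N1 N2 :=
  {mpoly R[i][#|{: 'I_n * 'I_(N1 + N2).+1}|]}.

Section QuadricAlgebra.

Variables (R : realType) (n N1 N2 : nat).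
Local Notation P := (lambda_ring R n N1 N2).

Definition lambda (i : 'I_n) (s : 'I_(N1 + N2).+1) : P :=
  'X_(enum_rank (i, s)).

(* The coefficient f[mode k]; here -2 N1 <= mode k <= 2 N2. *)
Definition fcoef (k : 'I_(2 * N1 + 2 * N2).+1) : P :=
  \sum_s \sum_(t | mode s + mode t == mode k)
    \sum_(i < n) lambda i s * lambda i t.

Definition AQ_ideal : {pred P} := gen_ideal fcoef.

Lemma AQ_ideal_proper : 1 \notin AQ_ideal.
Proof.
apply/asboolP => -[g /(congr1 (meval (fun=> 0)))/eqP].
rewrite meval1 raddf_sum big1 ?oner_eq0 // => k _ /=.
rewrite mevalM raddf_sum big1 ?mulr0 // => s _ /=.
rewrite raddf_sum big1 // => t _ /=; rewrite raddf_sum big1 // => i _ /=.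
by rewrite mevalM !mevalXU mulr0.
Qed.

HB.instance Definition _ :=
  isIdealr.Build P AQ_ideal (gen_ideal_closed AQ_ideal_proper).

Definition AQ := {ideal_quot AQ_ideal}.

HB.instance Definition _ := GRing.ComNzRing.on AQ.

Definition AQ_class (p : P) : AQ := \pi_{ideal_quot AQ_ideal} p.

Lemma AQ_class_is_zmod_morphism : zmod_morphism AQ_class.
Proof. by move=> p q; rewrite [LHS]raddfB. Qed.

Lemma AQ_class_is_monoid_morphism : monoid_morphism AQ_class.
Proof. by split=> [|p q]; [exact: rmorph1 | exact: rmorphM]. Qed.

HB.instance Definition _ := GRing.isZmodMorphism.Build
  P AQ AQ_class AQ_class_is_zmod_morphism.
HB.instance Definition _ := GRing.isMonoidMorphism.Build
  P AQ AQ_class AQ_class_is_monoid_morphism.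

(* AQ and the cohomology below are C[lambda]-algebras: a {lrmorphism _ -> _}
   between them is a morphism of C-algebras matching the classes of every
   polynomial. *)
Definition AQ_scale (p : P) (a : AQ) : AQ := AQ_class p * a.

Lemma AQ_scaleA p q a : AQ_scale p (AQ_scale q a) = AQ_scale (p * q) a.
Proof. by rewrite /AQ_scale rmorphM mulrA. Qed.

Lemma AQ_scale1 : left_id 1 AQ_scale.
Proof. by move=> a; rewrite /AQ_scale rmorph1 mul1r. Qed.

Lemma AQ_scaleDr : right_distributive AQ_scale +%R.
Proof. by move=> p a b; rewrite /AQ_scale mulrDr. Qed.

Lemma AQ_scaleDl a : {morph AQ_scale^~ a : p q / p + q}.
Proof. by move=> p q; rewrite /AQ_scale rmorphD mulrDl. Qed.

HB.instance Definition _ := GRing.Zmodule_isLmodule.Build P AQ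
  AQ_scaleA AQ_scale1 AQ_scaleDr AQ_scaleDl.

Lemma AQ_scaleAl p (a b : AQ) : p *: (a * b) = p *: a * b.
Proof. exact: mulrA. Qed.

HB.instance Definition _ := GRing.Lmodule_isLalgebra.Build P AQ AQ_scaleAl.

(* The cohomology algebra of C_(-N1)^N2(n). *)
Definition Ccohomology := koszul_cohomology fcoef.

HB.instance Definition _ := GRing.PzRing.on Ccohomology.
HB.instance Definition _ := GRing.Lmodule.on Ccohomology.
HB.instance Definition _ := GRing.PzSemiRing_isNonZero.Build Ccohomology
  (cohomology_1neq0 AQ_ideal_proper).

Lemma Ccohomology_scaleAl p (h h' : Ccohomology) :
  p *: (h * h') = p *: h * h'.
Proof. exact: mulrA. Qed.

HB.instance Definition _ :=
  GRing.Lmodule_isLalgebra.Build P Ccohomology Ccohomology_scaleAl.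

End QuadricAlgebra.

(* Main.v *)
(* The statement amounts to exactness of the Koszul complex in positive degree.
   In the null coordinates x = lambda^1 + i lambda^2, y = lambda^1 - i lambda^2,
   z = lambda^3 the quadrics become the sums of x[s] y[t] + z[s] z[t] + ... over
   s + t = k. Number the modes from 0. For a suitable weight on the variables
   the leading monomial of f[2p] is z[p]^2 and that of f[2p+1] is x[p] y[p+1],
   and these monomials are pairwise coprime.
   Polynomials whose leading monomials m_k are pairwise coprime with unit
   coefficients have an exact Koszul complex: let q_k be division by m_k, killing
   the monomials that m_k does not divide. Modulo terms of lower weight, the
   homotopy c_k q_k subtracts from a cocycle the terms that contain c_k or are
   divisible by m_k. Applying this for every k removes the top weight of a
   cocycle without c-free term, and one concludes by induction on the
   weight. *)
From HB Require Import structures.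
Require Import Defs.
From mathcomp Require Import all_boot all_order all_algebra.
From mathcomp Require Import boolp reals complex mpoly.
From mathcomp Require Import zify ring.

Set Implicit Arguments.
Unset Strict Implicit.
Unset Printing Implicit Defensive.

Import Order.TTheory GRing.Theory Num.Theory.
Local Open Scope ring_scope.

(** * Division of polynomials by a monomial *)

Section MonomialDivision.

Variables (A : comNzRingType) (v : nat).
Implicit Types (p q : {mpoly A[v]}) (b m l : 'X_{1..v}).

Definition mdivX m p : {mpoly A[v]} :=
  \sum_(b <- msupp p | (m <= b)%MM) p@_b *: 'X_[b - m].

Lemma mcoeff_mdivX m p b : (mdivX m p)@_b = p@_(b + m).
Proof.
rewrite /mdivX raddf_sum /=.
have E c : (m <= c)%MM -> (p@_c *: 'X_[c - m])@_b = p@_c * (c == b + m)%MM%:R.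
  move=> mc; rewrite mcoeffZ mcoeffX; congr (_ * _%:R).
  by congr (nat_of_bool _); apply/eqP/eqP => [<-|->]; rewrite ?addmK ?submK.
rewrite (eq_bigr _ E); have [bs|bs] := boolP ((b + m)%MM \in msupp p).
  rewrite -big_filter (bigD1_seq (b + m)%MM) ?filter_uniq ?msupp_uniq //=.
    by rewrite eqxx mulr1 big1 ?addr0 // => c /negPf->; rewrite mulr0.
  by rewrite mem_filter lem_addl.
rewrite memN_msupp_eq0 // big_seq_cond big1 // => c /andP[cs _].
by case: eqP cs bs => [->->|]; rewrite ?mulr0.
Qed.

Lemma mdivX_is_zmod_morphism m : zmod_morphism (mdivX m).
Proof.
by move=> p q; apply/mpolyP => b; rewrite mcoeffB !mcoeff_mdivX mcoeffB.
Qed.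

HB.instance Definition _ m := GRing.isZmodMorphism.Build
  {mpoly A[v]} {mpoly A[v]} (mdivX m) (mdivX_is_zmod_morphism m).

Lemma mcoeffXM m p b :
  ('X_[m] * p)@_b = if (m <= b)%MM then p@_(b - m) else 0.
Proof.
rewrite mulrC; case: ifP => [mb|mb].
  by rewrite -{1}(submK mb) addmC mcoeffMX.
apply: memN_msupp_eq0; apply: contraFN mb.
rewrite (perm_mem (msuppMX _ _)) => /mapP[c _ ->].
exact: lem_addr.
Qed.

Lemma mcoeff_XM_mdivX m p b :
  ('X_[m] * mdivX m p)@_b = if (m <= b)%MM then p@_b else 0.
Proof. by rewrite mcoeffXM mcoeff_mdivX; case: ifP => // mb; rewrite submK. Qed.

Lemma mdivX_XM m p : mdivX m ('X_[m] * p) = p.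
Proof. by apply/mpolyP => b; rewrite mcoeff_mdivX mcoeffXM lem_addl addmK. Qed.

(** As [m] and [l] have disjoint supports, [l] divides [b + m] exactly when it divides [b]. This
    makes division by one leading monomial commute with multiplication by all the others. *)
Lemma mdivX_XM_coprime m l p : (forall i, (m i == 0%N) || (l i == 0%N)) ->
  mdivX m ('X_[l] * p) = 'X_[l] * mdivX m p.
Proof.
move=> ml; apply/mpolyP => b; rewrite mcoeff_mdivX !mcoeffXM.
have -> : (l <= b + m)%MM = (l <= b)%MM.
  apply/mnm_lepP/mnm_lepP => lb i; have := lb i; have := ml i;
  rewrite mnmDE; lia.
case: ifP => // /mnm_lepP lb; rewrite mcoeff_mdivX; congr (_ @_ _).
apply/mnmP => i; rewrite !(mnmDE, mnmBE); have := lb i; lia.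
Qed.

End MonomialDivision.

(** * Signs and coefficientwise maps in the exterior algebra *)

Lemma ext_sign1E M (k : 'I_M) (S : {set 'I_M}) : k \notin S ->
  exists b : bool, forall A, ext_sign A [set k] S = (-1) ^+ b.
Proof.
(* Each [j < k] in [S] contributes a factor -1. The bit is chosen before the ring, so the same sign
   can be pulled through maps between different rings. *)
move=> kS; exists (odd #|[set j in S | (j < k)%N]|) => A.
rewrite /ext_sign big_set1 signr_odd -prodr_const [RHS]big_mkcond /=.
rewrite [LHS]big_mkcond /=; apply: eq_bigr => j _; rewrite inE.
have [jS|//] := boolP (j \in S); case: ltngtP => //= /val_inj kj.
by rewrite kj jS in kS.
Qed.

Section ExteriorSupplement.

Variables (A : comNzRingType) (M : nat).
Implicit Types (x y : extalg A M) (S : {set 'I_M}).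

Lemma ext_genME k y S : (ext_gen A k * y) S =
  if k \in S then ext_sign A [set k] (S :\ k) * y (S :\ k) else 0.
Proof.
rewrite [LHS]ffunE (bigD1 [set k]) //= [X in _ + X]big1 => [|T /negPf Tk].
  rewrite addr0 ffunE eqxx; case: ifPn => kS.
    rewrite (bigD1 (S :\ k)) /= ?setD1K // mulr1 big1 ?addr0 // => T.
    case/andP => [/eqP ST].
    have [kT|kT] := boolP (k \in T).
      by rewrite (ext_sign_meet (set11 k) kT) !mul0r.
    by case/eqP; rewrite -ST setU1K.
  by rewrite big1 // => T /eqP ST; rewrite -ST setU11 in kS.
by rewrite big1 // => U _; rewrite ffunE Tk mulr0 mul0r.
Qed.

Definition ext_map (B : comNzRingType) (q : A -> B) x : extalg B M :=
  [ffun S => q (x S)].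

Lemma ext_mapE (B : comNzRingType) (q : A -> B) x S : ext_map q x S = q (x S).
Proof. by rewrite ffunE. Qed.

Lemma extBE x y S : (x - y) S = x S - y S. Proof. by rewrite !ffunE. Qed.

Lemma ext_map_is_nmod_morphism (B : comNzRingType) (q : {additive A -> B}) :
  nmod_morphism (ext_map q).
Proof.
split=> [|x y]; apply/ffunP => S; first by rewrite ext_mapE !ffunE raddf0.
by rewrite ext_mapE !extE !ext_mapE raddfD.
Qed.

HB.instance Definition _ (B : comNzRingType) (q : {additive A -> B}) :=
  GRing.isNmodMorphism.Build (extalg A M) (extalg B M) (ext_map q)
    (ext_map_is_nmod_morphism q).

Lemma ext_deriv_map (B : comNzRingType) (q : {additive A -> B}) k x :
  ext_deriv k (ext_map q x) = ext_map q (ext_deriv k x).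
Proof.
apply/ffunP => S; rewrite ext_mapE !ext_derivE ext_mapE.
have [kS|/ext_sign1E[b sg]] := boolP (k \in S).
  by rewrite !(ext_sign_meet (set11 k) kS) !mul0r raddf0.
by rewrite !sg !mulr_sign; case: ifP; rewrite ?raddfN.
Qed.

End ExteriorSupplement.

(** * Commutator of an additive map with a linear combination *)

Section CommutatorSums.

Variables (A : comNzRingType) (V : lmodType A) (q : {additive V -> V}).
Variables (M : nat) (t u : 'I_M -> A) (y : 'I_M -> V).

(** Each coefficient is split into a tail [t l] and a leading term [u l]. Since [q] commutes with
    [u l] for [l != k], the leading terms contribute only at [k], where [q] undoes [u k]. *)
Lemma sum_commutatorD k :
  (forall l, l != k -> q (u l *: y l) = u l *: q (y l)) ->
  q (u k *: y k) = y k ->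
  \sum_l (t l + u l) *: q (y l) - q (\sum_l (t l + u l) *: y l) =
  \sum_l (t l *: q (y l) - q (t l *: y l)) - (y k - u k *: q (y k)).
Proof.
move=> qu qk; rewrite raddf_sum -sumrB.
rewrite (eq_bigr (fun l => t l *: q (y l) - q (t l *: y l)
  + (u l *: q (y l) - q (u l *: y l)))) => [|l _]; last first.
  by rewrite !scalerDl raddfD opprD addrACA.
rewrite big_split /=; congr (_ + _).
rewrite (bigD1 k) //= [X in _ + X]big1 => [|l /qu->].
  by rewrite addr0 qk opprB.
by rewrite subrr.
Qed.

End CommutatorSums.

(** * Exactness for pairwise coprime leading monomials *)

Section CoprimeLeadingMonomials.

Variables (A : comNzRingType) (v M : nat) (w : 'I_v -> nat).
Variables (f : 'I_M -> {mpoly A[v]}) (m : 'I_M -> 'X_{1..v}).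
Local Notation P := {mpoly A[v]}.
Local Notation E := (extalg P M).

Definition mnm_wt (b : 'X_{1..v}) : nat := (\sum_i b i * w i)%N.

Lemma mnm_wtD b c : mnm_wt (b + c)%MM = (mnm_wt b + mnm_wt c)%N.
Proof.
by rewrite -big_split; apply: eq_bigr => i _; rewrite mnmDE mulnDl.
Qed.

Hypothesis f_lead : forall k b,
  (f k - 'X_[m k])@_b != 0 -> (mnm_wt b < mnm_wt (m k))%N.
Hypothesis m_coprime : forall k l, k != l ->
  forall i, (m k i == 0%N) || (m l i == 0%N).

Implicit Types (x y : E) (S : {set 'I_M}) (B : int) (k l : 'I_M).

(** Giving c_k the weight of [m k] makes the leading part of the differential preserve weight. *)
Definition ext_wt S (b : 'X_{1..v}) : nat :=
  (mnm_wt b + \sum_(k in S) mnm_wt (m k))%N.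

(** The bound is an integer because the estimates lower it by weights of monomials, possibly below
    zero. *)
Definition wt_lt B x := forall S b, (x S)@_b != 0 -> (ext_wt S b)%:Z < B.

Lemma ext_wtU1 k S b : k \notin S ->
  ext_wt (k |: S) b = (ext_wt S b + mnm_wt (m k))%N.
Proof. by move=> kS; rewrite /ext_wt big_setU1 //= addnCA addnC. Qed.

Lemma wt_lt0 B : wt_lt B 0.
Proof. by move=> S b; rewrite ffunE mcoeff0 eqxx. Qed.

Lemma wt_ltN B x : wt_lt B x -> wt_lt B (- x).
Proof.
by move=> xB S b; rewrite ffunE mcoeffN oppr_eq0; apply: xB.
Qed.

Lemma wt_ltD B x y : wt_lt B x -> wt_lt B y -> wt_lt B (x + y).
Proof.
move=> xB yB S b; rewrite extE mcoeffD => xy.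
have [x0|/xB //] := eqVneq (x S)@_b 0.
by apply: yB; apply: contraNneq xy => ->; rewrite x0 addr0.
Qed.

Lemma wt_lt_sum B (F : 'I_M -> E) :
  (forall k, wt_lt B (F k)) -> wt_lt B (\sum_k F k).
Proof.
by move=> FB; elim/big_ind: _ => //; [exact: wt_lt0 | exact: wt_ltD].
Qed.

(** Monomials of the tail weigh at least one unit less than [m k], which absorbs the [+ 1] of the
    hypothesis. *)
Lemma wt_lt_tail k B x :
  wt_lt (B + 1) x -> wt_lt (B + (mnm_wt (m k))%:Z) ((f k - 'X_[m k]) *: x).
Proof.
move=> xB S b; rewrite extZE => ne0.
have /msuppM_le/allpairsP[[b1 b2] /= [b1P b2P ->]] :
  b \in msupp ((f k - 'X_[m k]) * x S) by rewrite mcoeff_msupp.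
move: b1P b2P; rewrite !mcoeff_msupp => /f_lead b1k /xB.
rewrite /ext_wt mnm_wtD; lia.
Qed.

Lemma wt_lt_mdivX k B x : wt_lt (B + (mnm_wt (m k))%:Z) x ->
  wt_lt B (ext_map (mdivX (m k)) x).
Proof.
move=> xB S b; rewrite ffunE mcoeff_mdivX => /xB.
rewrite /ext_wt mnm_wtD; lia.
Qed.

Lemma ext_derivN k x S : k \in S -> ext_deriv k x S = 0.
Proof. by move=> kS; rewrite ext_derivE (ext_sign_meet (set11 k) kS) mul0r. Qed.

Lemma mcoeff_ext_sign_eq0 k S (p : P) b : k \notin S ->
  ((ext_sign P [set k] S * p)@_b == 0) = (p@_b == 0).
Proof.
move=> /ext_sign1E[s ->]; rewrite mulr_sign.
by case: ifP; rewrite ?mcoeffN ?oppr_eq0.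
Qed.

Lemma wt_lt_deriv k B x : wt_lt (B + (mnm_wt (m k))%:Z) x ->
  wt_lt B (ext_deriv k x).
Proof.
move=> xB S b; have [kS|kS] := boolP (k \in S).
  by rewrite ext_derivN // mcoeff0 eqxx.
rewrite ext_derivE mcoeff_ext_sign_eq0 // => /xB.
rewrite ext_wtU1 //; lia.
Qed.

Lemma wt_lt_gen k B x : wt_lt B x ->
  wt_lt (B + (mnm_wt (m k))%:Z) (ext_gen P k * x).
Proof.
move=> xB S b; rewrite ext_genME; case: ifPn => kS; last first.
  by rewrite mcoeff0 eqxx.
rewrite mcoeff_ext_sign_eq0 ?setD11 // => /xB.
have := @ext_wtU1 k (S :\ k) b; rewrite setD11 setD1K // => -> //; lia.
Qed.

(** * The homotopy c_k q_k and its effect on the top weight *)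

Definition reduction k x : E :=
  x - koszul_diff f (ext_gen P k * ext_map (mdivX (m k)) x).

Let tail k := f k - 'X_[m k].
Let q k : {additive E -> E} := ext_map (mdivX (m k)).

Let qE k y S : q k y S = mdivX (m k) (y S). Proof. exact: ext_mapE. Qed.

(* [reduction k x] is [top k x] plus terms of lower weight, for x a cocycle. *)
Let low k x : E := ext_gen P k *
    (\sum_l (tail l *: q k (ext_deriv l x) - q k (tail l *: ext_deriv l x)))
  - tail k *: q k x.

Let top k x : E := (x - 'X_[m k] *: q k x)
  - ext_gen P k * (ext_deriv k x - 'X_[m k] *: q k (ext_deriv k x)).

(** On a cocycle, [koszul_diff f (q k x)] is the commutator of the differential with [q k].
    Coprimality removes the leading terms of index other than [k]. *)
Let koszul_diff_q k x : koszul_diff f x = 0 -> koszul_diff f (q k x) =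
  \sum_l (tail l *: q k (ext_deriv l x) - q k (tail l *: ext_deriv l x))
  - (ext_deriv k x - 'X_[m k] *: q k (ext_deriv k x)).
Proof.
move=> dx.
rewrite -[RHS](@sum_commutatorD P E (q k) M tail (fun l => 'X_[m l])
  (fun l => ext_deriv l x) k) => [|l lk|]; first last.
- by apply/ffunP => S; rewrite qE extZE mdivX_XM.
- apply/ffunP => S; rewrite qE [RHS]extZE extZE mdivX_XM_coprime ?qE // => i.
  by apply: m_coprime; rewrite eq_sym.
have fE l : tail l + 'X_[m l] = f l by rewrite subrK.
have -> : \sum_l (tail l + 'X_[m l]) *: ext_deriv l x = 0.
  by rewrite -[RHS]dx; apply: eq_bigr => l _; rewrite fE.
rewrite raddf0 subr0; apply: eq_bigr => l _; rewrite fE; congr (_ *: _).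
exact: ext_deriv_map.
Qed.

Let addr_regroup (V : zmodType) (x a b c d : V) :
  x - (b + a - (c - d)) = x - a - d + (c - b).
Proof.
rewrite opprB opprD -[RHS]addrA -[RHS]addrA; congr (x + _).
by rewrite [RHS]addrC addrA; congr (_ - a); rewrite addrCA addrA.
Qed.

(** The Leibniz rule turns the boundary into f_k q_k x - c_k d(q_k x); splitting f_k into leading
    monomial and tail sorts the terms. *)
Lemma reductionE k x : koszul_diff f x = 0 -> reduction k x = top k x + low k x.
Proof.
move=> dx; rewrite /reduction koszul_diff_Leibniz koszul_diff_gen.
have -> : koszul_diff f (ext_map (mdivX (m k)) x) = koszul_diff f (q k x) by [].
rewrite koszul_diff_q //.
have -> : ext_invol (ext_gen P k) = - ext_gen P k.
  by rewrite ext_invol_mon cards1 expr1 scaleN1r.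
rewrite -scalerAl mul1r mulNr mulrBr.
have -> : f k = tail k + 'X_[m k] by rewrite subrK.
rewrite scalerDl; exact: addr_regroup.
Qed.

Let divX_part k x S b : ((x - 'X_[m k] *: q k x) S)@_b =
  if (m k <= b)%MM then 0 else (x S)@_b.
Proof.
rewrite extBE extZE qE mcoeffB mcoeff_XM_mdivX.
by case: ifP; rewrite ?subrr ?subr0.
Qed.

(** The first bracket of [top] drops the monomials divisible by [m k]. The second lives on the sets
    containing [k], where c_k d/dc_k restores [x], so there the two brackets cancel. *)
Let mcoeff_top k x S b : (top k x S)@_b =
  if (k \in S) || (m k <= b)%MM then 0 else (x S)@_b.
Proof.
rewrite /top extBE mcoeffB divX_part ext_genME.
have [kS|kS] /= := boolP (k \in S); last by rewrite mcoeff0 subr0.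
have kS' : k \notin S :\ k by rewrite setD11.
have [s sg] := ext_sign1E kS'.
have := divX_part k (ext_deriv k x) (S :\ k) b.
rewrite [ext_deriv k x (S :\ k)]ext_derivE setD1K // sg !mulr_sign.
case: s {sg}; rewrite ?mcoeffN => ->; case: ifP => _;
  by rewrite ?opprK ?oppr0 ?subrr ?addr0 ?mcoeffN ?subrr.
Qed.

(** Every term of [low] contains exactly one tail, which costs at least one unit; the shifts due to
    c_k, q_k, the derivative and the leading weights cancel. *)
Let wt_lt_low k B x : wt_lt (B + 1) x -> wt_lt B (low k x).
Proof.
move=> xB; apply: wt_ltD; last first.
  apply: wt_ltN; rewrite -[B](subrK (mnm_wt (m k))%:Z).
  by apply/wt_lt_tail/wt_lt_mdivX; rewrite addrAC subrK.
rewrite -[B](subrK (mnm_wt (m k))%:Z); apply/wt_lt_gen/wt_lt_sum => l.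
apply: wt_ltD.
  rewrite -[_ - _](subrK (mnm_wt (m l))%:Z).
  apply/wt_lt_tail/wt_lt_mdivX/wt_lt_deriv.
  by rewrite [X in wt_lt X _](_ : _ = B + 1) //; ring.
apply/wt_ltN/wt_lt_mdivX; rewrite subrK -[B](subrK (mnm_wt (m l))%:Z).
by apply/wt_lt_tail/wt_lt_deriv; rewrite addrAC subrK.
Qed.

Lemma wt_lt_reduction k B x : koszul_diff f x = 0 -> wt_lt (B + 1) x ->
  wt_lt (B + 1) (reduction k x).
Proof.
move=> dx xB S b; rewrite reductionE // extE mcoeffD mcoeff_top => ne0.
have [x0|/xB //] := eqVneq ((x S)@_b) 0.
by move: ne0; rewrite x0 if_same add0r => /(wt_lt_low xB); lia.
Qed.

Lemma mcoeff_reduction k B x S b : koszul_diff f x = 0 -> wt_lt (B + 1) x ->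
  (ext_wt S b)%:Z = B -> (reduction k x S)@_b =
  if (k \in S) || (m k <= b)%MM then 0 else (x S)@_b.
Proof.
move=> dx xB wB; rewrite reductionE // extE mcoeffD mcoeff_top.
rewrite [X in _ + X](_ : _ = 0) ?addr0 //; apply/eqP.
by apply: contraT => /(wt_lt_low xB); rewrite wB ltxx.
Qed.

(** Only the c_k component of c_k q_k x could reach the c-free part of the boundary, and it is the
    quotient of [x set0]. *)
Lemma reduction_set0 k x : x set0 = 0 -> reduction k x set0 = 0.
Proof.
move=> x0; rewrite extBE x0 sub0r ext_sumE big1 ?oppr0 // => l _.
rewrite extZE ext_derivE ext_genME ext_mapE setU0 in_set1.
case: eqP => [->|]; last by rewrite !mulr0.
by rewrite setDv x0 raddf0 !mulr0.
Qed.

Lemma reduction_closed k x :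
  koszul_diff f x = 0 -> koszul_diff f (reduction k x) = 0.
Proof. by move=> dx; rewrite /reduction linearB /= dx koszul_diffK subrr. Qed.

Lemma lower_wt_representative B x :
  koszul_diff f x = 0 -> x set0 = 0 -> wt_lt (B + 1) x ->
  exists y, [/\ koszul_diff f (x - koszul_diff f y) = 0,
    (x - koszul_diff f y) set0 = 0 & wt_lt B (x - koszul_diff f y)].
Proof.
move=> dx x0 xB.
have [y [dy y0 yB yr]] : exists y, [/\ koszul_diff f (x - koszul_diff f y) = 0,
    (x - koszul_diff f y) set0 = 0, wt_lt (B + 1) (x - koszul_diff f y)
    & forall S b, (ext_wt S b)%:Z = B ->
      has (fun k => k \in S) (enum 'I_M) -> ((x - koszul_diff f y) S)@_b = 0].
  (* Invariant: in weight [B], components on sets meeting the list vanish. A further reduction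
     preserves this, since in weight [B] it only erases coefficients. *)
  elim: (enum 'I_M) => [|k r [y [dy y0 yB yr]]].
    by exists 0; rewrite linear0 subr0.
  exists (y + ext_gen P k * ext_map (mdivX (m k)) (x - koszul_diff f y)).
  rewrite [koszul_diff f (y + _)]linearD /=.
  rewrite [- (koszul_diff f y + _)]opprD addrA.
  rewrite -/(reduction k (x - koszul_diff f y)).
  split; [exact: reduction_closed | exact: reduction_set0 |
          exact: wt_lt_reduction | move=> S b wB /= kr].
  rewrite (mcoeff_reduction _ dy yB wB); case: ifP => // kS.
  by apply: yr => //; case: (k \in S) kS kr.
exists y; split=> // S b ne0.
have [S0|/set0Pn[k kS]] := eqVneq S set0.
  by rewrite S0 y0 mcoeff0 eqxx in ne0.
have := yB _ _ ne0; have [/yr wB _|] := eqVneq (ext_wt S b)%:Z B; last lia.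
rewrite wB ?eqxx // in ne0; apply/hasP; exists k => //; exact: mem_enum.
Qed.

Lemma koszul_exact_coprime x :
  koszul_diff f x = 0 -> x set0 = 0 -> exists y, x = koszul_diff f y.
Proof.
have [B] : exists B : nat, wt_lt B%:Z x.
  exists (\max_S \max_(b <- msupp (x S)) ext_wt S b).+1 => S b.
  rewrite -mcoeff_msupp => bS; rewrite ltz_nat ltnS.
  apply: leq_trans (leq_bigmax S).
  exact: (@leq_bigmax_seq _ _ xpredT (fun b => ext_wt S b)).
elim: B x => [|B IHB] x xB dx x0.
  (* Weights are natural numbers, so the bound 0 forces [x = 0]. *)
  exists 0; rewrite linear0; apply/ffunP => S; rewrite ffunE; apply/mpolyP => b.
  by rewrite mcoeff0; apply/eqP; apply: contraT => /xB.
have xB' : wt_lt (B%:Z + 1) x by move: xB; rewrite -addn1 PoszD.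
have [y [dy y0 /IHB[//|//|z xyz]]] := lower_wt_representative dx x0 xB'.
by exists (y + z); rewrite linearD /= -xyz addrC subrK.
Qed.

End CoprimeLeadingMonomials.

(** * Coordinate changes and the weights in null coordinates *)

Lemma koszul_diff_map (A B : comNzRingType) (M : nat) (t : {rmorphism A -> B})
  (f : 'I_M -> A) (x : extalg A M) :
  koszul_diff (t \o f) (ext_map t x) = ext_map t (koszul_diff f x).
Proof.
rewrite /koszul_diff raddf_sum; apply: eq_bigr => k _.
rewrite ext_deriv_map; apply/ffunP => S.
rewrite [ext_map t (_ *: _) S]ext_mapE !extZE rmorphM; congr (_ * _).
exact: ext_mapE.
Qed.

Lemma comp_mpolyK (A : comNzRingType) (v : nat) (g h : v.-tuple {mpoly A[v]}) :
  (forall j, tnth h j \mPo g = 'X_j) -> cancel (comp_mpoly h) (comp_mpoly g).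
Proof.
move=> gh p; rewrite {1}[p]mpolyE [_ \mPo h]linear_sum linear_sum [RHS]mpolyE.
rewrite /=; apply: eq_bigr => b _; rewrite !comp_mpolyZ; congr (_ *: _).
rewrite comp_mpolyX [LHS]rmorph_prod [RHS]mpolyXE_id /=.
by apply: eq_bigr => j _; rewrite [LHS]rmorphXn /= gh.
Qed.

(* Weights of x[s], y[s], z[s] and of the other variables, for i = 0, 1, 2 and
   i > 2. Up to constants they are - 2 s^2 - 2 s, - 2 s^2 + 2 s, - 2 s^2 and
   - 2 s^2: concavity favours products of nearby modes, the linear terms make
   x[p] y[p+1] win for odd k; the constants make z[p]^2 win for even k and keep
   the truncated differences exact for s <= N. *)
Definition null_wt (N i s : nat) : nat :=
  (if i == 0 then 2 * N * N + 2 * N - (2 * s * s + 2 * s)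
   else if i == 1 then 2 * N * N + 2 * N + 1 + 2 * s - 2 * s * s
   else if i == 2 then 2 * N * N + 2 * N + 1 - 2 * s * s
   else 2 * N * N + 2 * N - 2 * s * s)%N.

(** With [s] and [t] equal to p + e and p - e in some order, concavity costs 4 e^2. The linear terms
    of an x y pair gain at most 4 e, which [e <= e * e] compensates, and the constants leave z[p]^2
    ahead by at least one. *)
Lemma null_wt_even (N i s t p : nat) : (s <= N)%N -> (t <= N)%N -> i != 1%N ->
  (s + t = p.*2)%N -> ~~ ((i == 2%N) && (s == p)) ->
  (null_wt N i s + null_wt N (if i == 0 then 1 else i) t
   < null_wt N 2 p + null_wt N 2 p)%N.
Proof.
move=> sN tN i1 st ne.
have sN2 : (s * s <= N * N)%N by apply: leq_mul.
have tN2 : (t * t <= N * N)%N by apply: leq_mul.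
wlog: / exists e, (s = t + 2 * e /\ p = t + e \/ t = s + 2 * e /\ p = s + e)%N.
  apply; have [ts|ts] := leqP s t; [exists (p - s)%N | exists (p - t)%N]; lia.
case=> e se; have ee : (e <= e * e)%N by case: (e) => // e'; rewrite leq_pmulr.
have pN : (p <= N)%N by lia.
have pN2 : (p * p <= N * N)%N by apply: leq_mul.
rewrite /null_wt; case: i i1 ne => [|[|[|i]]] //= _ ne;
  by case: se => -[? ?]; subst; nia.
Qed.

(** With |s - t| = 2 e + 1, a pair x[s] y[t] with s < t falls 4 e^2 below x[p] y[p+1], and one with
    s > t falls further. Pairs of equal index lack the linear gain and fall short by at least
    one. *)
Lemma null_wt_odd (N i s t p : nat) : (s <= N)%N -> (t <= N)%N -> i != 1%N ->
  (s + t = p.*2.+1)%N -> ~~ ((i == 0%N) && (s == p)) ->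
  (null_wt N i s + null_wt N (if i == 0 then 1 else i) t
   < null_wt N 0 p + null_wt N 1 p.+1)%N.
Proof.
move=> sN tN i1 st ne.
have sN2 : (s * s <= N * N)%N by apply: leq_mul.
have tN2 : (t * t <= N * N)%N by apply: leq_mul.
wlog: / exists e, (s = t + 2 * e + 1 /\ p = t + e \/
                   t = s + 2 * e + 1 /\ p = s + e)%N.
  apply; have [ts|ts] := leqP s t; [exists (p - s)%N | exists (p - t)%N]; lia.
case=> e se; have ee : (e <= e * e)%N by case: (e) => // e'; rewrite leq_pmulr.
have pN : (p.+1 <= N)%N by lia.
have pN2 : (p.+1 * p.+1 <= N * N)%N by apply: leq_mul.
rewrite /null_wt; case: i i1 ne => [|[|[|i]]] //= _ ne;
  by case: se => -[? ?]; subst; nia.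
Qed.

(** * The quadrics in null coordinates and their leading monomials *)

Section QuadricLeadingMonomials.

Variables (F : fieldType) (imag : F) (n N1 N2 : nat).
Hypothesis imag_sqr : imag ^+ 2 = -1.
Hypothesis two_neq0 : 2 != 0 :> F.
Hypothesis n_ge3 : (3 <= n)%N.

Local Notation N := (N1 + N2)%N.
Local Notation var := ('I_n * 'I_N.+1)%type.
Local Notation P := {mpoly F[#|{: var}|]}.
Local Notation M := (2 * N1 + 2 * N2).+1.

Let i0 : 'I_n := Ordinal (leq_trans (isT : 0 < 3)%N n_ge3).
Let i1 : 'I_n := Ordinal (leq_trans (isT : 1 < 3)%N n_ge3).
Let i2 : 'I_n := Ordinal (leq_trans (isT : 2 < 3)%N n_ge3).

Let lam (i : 'I_n) (s : 'I_N.+1) : P := 'X_(enum_rank (i, s)).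

(** The formula of [fcoef] over any field with a square root of -1 and 2 invertible. *)
Definition quadric (k : 'I_M) : P :=
  \sum_s \sum_(t | mode s + mode t == mode k) \sum_(i < n) lam i s * lam i t.

Let subst (h : var -> P) := [tuple h (enum_val j) | j < #|{: var}|].

Let comp_lam h i s : lam i s \mPo subst h = h (i, s).
Proof. by rewrite comp_mpolyXU -tnth_nth tnth_mktuple enum_rankK. Qed.

(** In the new ring the variables of index [i0] and [i1] stand for x and y. [to_null] replaces them
    by their expressions in the old variables; [of_null] expresses the old variables through x and
    y. *)
Let to_null (a : var) : P :=
  if a.1 == i0 then lam i0 a.2 + imag *: lam i1 a.2
  else if a.1 == i1 then lam i0 a.2 - imag *: lam i1 a.2
  else lam a.1 a.2.

Let of_null (a : var) : P :=
  if a.1 == i0 then 2^-1 *: (lam i0 a.2 + lam i1 a.2)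
  else if a.1 == i1 then (2 * imag)^-1 *: (lam i0 a.2 - lam i1 a.2)
  else lam a.1 a.2.

Let imag_neq0 : imag != 0.
Proof. by rewrite -sqrf_eq0 imag_sqr oppr_eq0 oner_eq0. Qed.

Let of_nullK : cancel (comp_mpoly (subst of_null)) (comp_mpoly (subst to_null)).
Proof.
apply: comp_mpolyK => j; rewrite tnth_mktuple -[j in RHS]enum_valK.
case: (enum_val j) => i s; rewrite -/(lam i s) /of_null /=.
have [->|i0'] := eqVneq i i0; last have [->|i1'] := eqVneq i i1.
- rewrite comp_mpolyZ comp_mpolyD !comp_lam /to_null eqxx /=.
  rewrite addrACA subrr addr0 -mulr2n -scaler_nat scalerA mulVf ?scale1r //.
- rewrite comp_mpolyZ comp_mpolyB !comp_lam /to_null eqxx /=.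
  rewrite opprB addrC addrA subrK -mulr2n -scaler_nat !scalerA.
  by rewrite -mulrA mulVf ?scale1r // mulf_neq0.
by rewrite comp_lam /to_null /= (negPf i0') (negPf i1').
Qed.

(** The index [i0] carries the product x[s] y[t], so sums over these monomials skip [i1]. *)
Let null_mon (a : 'I_N.+1 * 'I_N.+1 * 'I_n) : 'X_{1..#|{: var}|} :=
  (U_(enum_rank (a.2, a.1.1))
   + U_(enum_rank (if a.2 == i0 then i1 else a.2, a.1.2)))%MM.

Let null_product (x y x' y' : P) :
  (2 * imag)^-1 *: (x - y) * ((2 * imag)^-1 *: (x' - y'))
  + 2^-1 *: (x + y) * (2^-1 *: (x' + y')) = 2^-1 *: (x * y') + 2^-1 *: (x' * y).
Proof.
rewrite -!scalerAl -!scalerAr !scalerA -!invfM.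
have -> : 2 * imag * (2 * imag) = - (2 * 2).
  by rewrite mulrACA -[imag * imag]expr2 imag_sqr mulrN1.
rewrite invrN scaleNr addrC -scalerBr -scalerDr.
have -> : (x + y) * (x' + y') - (x - y) * (x' - y') = (x * y' + x' * y) *+ 2.
  by ring.
by rewrite -scaler_nat scalerA invfM mulfVK.
Qed.

Let quadric_null (k : 'I_M) : quadric k \mPo subst of_null =
  \sum_(a : 'I_N.+1 * 'I_N.+1 * 'I_n | (a.1.1 + a.1.2 == k)%N && (a.2 != i1))
    'X_[null_mon a].
Proof.
have modeE (s t : 'I_N.+1) : (mode s + mode t == mode k) = (s + t == k)%N.
  by rewrite /mode; apply/eqP/eqP; lia.
pose S2 (G : 'I_N.+1 -> 'I_N.+1 -> P) :=
  \sum_(s : 'I_N.+1) \sum_(t : 'I_N.+1 | (s + t == k)%N) G s t.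
have S2E G : S2 G =
    \sum_(st : 'I_N.+1 * 'I_N.+1 | (st.1 + st.2 == k)%N) G st.1 st.2.
  by rewrite /S2 pair_big_dep.
have S2C G : S2 (fun s t => G t s) = S2 G.
  rewrite /S2 (exchange_big_dep xpredT) //=; apply: eq_bigr => s _.
  by apply: eq_bigl => t; rewrite addnC.
have S2D G H : S2 (fun s t => G s t + H s t) = S2 G + S2 H.
  by rewrite /S2 -big_split; apply: eq_bigr => s _; rewrite big_split.
have S2Z c G : S2 (fun s t => c *: G s t) = c *: S2 G.
  by rewrite /S2 scaler_sumr; apply: eq_bigr => s _; rewrite scaler_sumr.
pose rest s t := \sum_(i | (i != i1) && (i != i0)) lam i s * lam i t.
have -> : quadric k \mPo subst of_null =
    S2 (fun s t => 2^-1 *: (lam i0 s * lam i1 t) + 2^-1 *: (lam i0 t * lam i1 s)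
                   + rest s t).
  rewrite /quadric [LHS]raddf_sum; apply: eq_bigr => s _.
  rewrite [LHS]raddf_sum; apply: eq_big => [t|t _]; first exact: modeE.
  rewrite [LHS]raddf_sum (bigD1 i1) //= (bigD1 i0) //= addrA; congr (_ + _).
    rewrite !rmorphM /= !comp_lam /of_null /=.
    exact: null_product.
  apply: eq_bigr => i /andP[/negPf i1' /negPf i0'].
  by rewrite rmorphM /= !comp_lam /of_null i0' i1'.
(* Exchanging [s] and [t] identifies the two halves, so x[s] y[t] gets coefficient one. *)
rewrite S2D S2D !S2Z (S2C (fun s t => lam i0 s * lam i1 t)) -scalerDr.
rewrite -mulr2n -scaler_nat scalerA mulVf ?scale1r // -S2D S2E.
rewrite -(pair_big_dep (fun st : 'I_N.+1 * 'I_N.+1 => (st.1 + st.2 == k)%N)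
   (fun _ i => i != i1) (fun st i => 'X_[null_mon (st, i)])) /=.
apply: eq_bigr => -[s t] _ /=; rewrite (bigD1 i0) //= /null_mon /=.
rewrite mpolyXD; congr (_ + _); apply: eq_bigr => i /andP[_ /negPf i0'].
by rewrite i0' mpolyXD.
Qed.

(** An odd [k] is at most 2 N - 1, so [k./2.+1] is at most N and [inord] never returns its
    default. *)
Let lead (k : 'I_M) : 'I_N.+1 * 'I_N.+1 * 'I_n :=
  if odd k then (inord k./2, inord k./2.+1, i0)
  else (inord k./2, inord k./2, i2).

Let wt (j : 'I_#|{: var}|) : nat := null_wt N (enum_val j).1 (enum_val j).2.

Let wt_U i s : mnm_wt wt U_(enum_rank (i, s)) = null_wt N i s.
Proof.
rewrite /mnm_wt (bigD1 (enum_rank (i, s))) //= big1 => [|j].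
  by rewrite mnm1E eqxx mul1n addn0 /wt enum_rankK.
by move=> /negPf jU; rewrite mnm1E eq_sym jU.
Qed.

Let wt_null_mon a : mnm_wt wt (null_mon a) =
  (null_wt N a.2 a.1.1 + null_wt N (if val a.2 == 0 then 1 else a.2) a.1.2)%N.
Proof.
by rewrite mnm_wtD !wt_U -[a.2 == i0]val_eqE; case: (val a.2 == 0%N).
Qed.

Let lead_cond k : ((lead k).1.1 + (lead k).1.2 == k)%N && ((lead k).2 != i1).
Proof.
have kM := ltn_ord k; rewrite /lead; case: ifP => k2 /=; rewrite !inordK; lia.
Qed.

Let quadric_null_lead k b :
  (quadric k \mPo subst of_null - 'X_[null_mon (lead k)])@_b != 0 ->
  (mnm_wt wt b < mnm_wt wt (null_mon (lead k)))%N.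
Proof.
rewrite quadric_null (bigD1 (lead k)) ?lead_cond //= addrC addrK raddf_sum /=.
apply: contraR => wtb; apply/eqP/big1 => -[[s t] i] /=.
case/andP=> /andP[/eqP st i1'] ne.
rewrite mcoeffX; case: eqP wtb => //= <- /negP[]; rewrite !wt_null_mon /=.
have [sN tN] := (ltn_ord s, ltn_ord t); have kM := ltn_ord k.
move: ne; rewrite /lead; case: ifP => k2 ne /=; rewrite !inordK; try lia.
  apply: null_wt_odd => //; first lia.
  (* As s + t = k, agreement of [i] and [s] with [lead k] already forces the same triple. *)
  apply: contra ne => /andP[/eqP i0E /eqP sE].
  by apply/eqP; congr (_, _, _); apply: val_inj; rewrite /= ?inordK; lia.
apply: null_wt_even => //; first lia.
apply: contra ne => /andP[/eqP i0E /eqP sE].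
by apply/eqP; congr (_, _, _); apply: val_inj; rewrite /= ?inordK; lia.
Qed.

(* A variable of a leading monomial determines k, whence coprimality. *)
Let lead_var k j : null_mon (lead k) j != 0%N ->
  let: (i, s) := enum_val j in
  val k = (if val i == 0 then 2 * s + 1
           else if val i == 1 then 2 * s - 1 else 2 * s)%N.
Proof.
have kM := ltn_ord k.
rewrite mnmDE !mnm1E addn_eq0 negb_and !eqb0 !negbK => /orP[] /eqP <-;
  rewrite enum_rankK /lead; have [k2|k2] := boolP (odd k);
  rewrite /= ?eqxx /= inordK; lia.
Qed.

Let lead_coprime k l : k != l ->
  forall j, (null_mon (lead k) j == 0%N) || (null_mon (lead l) j == 0%N).
Proof.
move=> kl j; apply: contraR kl; rewrite negb_or.
case/andP=> /lead_var kj /lead_var lj.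
by apply/eqP/val_inj; move: kj lj; case: (enum_val j) => i s /= -> ->.
Qed.

Lemma quadric_koszul_exact (x : extalg P M) :
  koszul_diff quadric x = 0 -> x set0 = 0 ->
  exists y, x = koszul_diff quadric y.
Proof.
move=> dx x0.
pose t : {rmorphism P -> P} := comp_mpoly (subst of_null).
pose u : {rmorphism P -> P} := comp_mpoly (subst to_null).
have [||y txy] := koszul_exact_coprime quadric_null_lead lead_coprime
  (x := ext_map t x).
- by rewrite [LHS](koszul_diff_map t quadric) dx raddf0.
- by rewrite ext_mapE x0 raddf0.
(* [u] inverts [t] on coefficients and carries the transformed quadrics back, hence also the
   primitive. *)
exists (ext_map u y).
have utK (z : extalg P M) : ext_map u (ext_map t z) = z.
  by apply/ffunP => S; rewrite !ext_mapE; apply: of_nullK.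
rewrite -[LHS]utK txy -koszul_diff_map; congr (koszul_diff _ _).
by apply/funext => k; apply: of_nullK.
Qed.

End QuadricLeadingMonomials.

(** * Cohomology classes of degree zero *)

Section ConstantClasses.

Variables (A : comNzRingType) (M : nat) (f : 'I_M -> A).

Lemma ext_algE (a : A) : a%:A = a *: ext_mon A set0 :> extalg A M.
Proof. by []. Qed.

Lemma ext_homog0 (x : extalg A M) : ext_homog 0 x <-> x = (x set0)%:A.
Proof.
split=> [x0|x0 S].
  apply/ffunP => S; rewrite ext_algE extZE ffunE.
  have [->|S0] := eqVneq S set0; first by rewrite mulr1.
  rewrite mulr0; apply: contraNeq S0 => /x0/eqP; by rewrite cards_eq0.
rewrite x0 ext_algE extZE ffunE.
have [->|_] := eqVneq S set0; first by rewrite cards0.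
by rewrite mulr0 eqxx.
Qed.

Lemma koszul_diff_set0 (y : extalg A M) :
  koszul_diff f y set0 = \sum_k y [set k] * f k.
Proof.
rewrite ext_sumE; apply: eq_bigr => k _.
by rewrite extZE ext_derivE ext_signs0 setU0 mul1r mulrC.
Qed.

(** The c-free part of a boundary is a combination of the f_k; conversely the sum of the g_k c_k has
    boundary the sum of the g_k f_k. *)
Lemma exact_algP (a : A) :
  (exists y, a%:A = koszul_diff f y) <-> a \in gen_ideal f.
Proof.
split=> [[y ay]|/asboolP[g ->]].
  apply/asboolP; exists (fun k => y [set k]); rewrite -koszul_diff_set0 -ay.
  by rewrite ext_algE extZE ffunE eqxx mulr1.
exists (\sum_k g k *: ext_gen A k); rewrite scaler_suml linear_sum.
by apply: eq_bigr => k _; rewrite linearZ /= koszul_diff_gen scalerA.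
Qed.

Lemma cohomology_class_alg_eq (a b : A) :
  cohomology_class (a%:A : koszul_cocycle f) = cohomology_class b%:A <->
  a - b \in gen_ideal f.
Proof.
rewrite -exact_algP; split.
  move/cohomology_classP/koszul_exactP => [y aby]; exists y.
  by rewrite -aby raddfB scalerBl.
move=> [y aby]; apply/cohomology_classP/koszul_exactP; exists y.
by rewrite -aby raddfB scalerBl.
Qed.

Lemma cohomology_part0P (h : koszul_cohomology f) :
  cohomology_part 0 h <-> exists a : A, h = cohomology_class a%:A.
Proof.
split=> [[z /ext_homog0 z0 ->]|[a ->]].
  exists (val z set0); congr cohomology_class.
  by apply: val_inj; rewrite /= {1}z0.
exists a%:A => //; apply/(ext_homog0 (a%:A : extalg A M)).
by rewrite [in RHS]ext_algE extZE ffunE eqxx mulr1.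
Qed.

End ConstantClasses.

(** * The algebra morphism from [AQ] to cohomology *)

Section AQToCohomology.

Variables (R : realType) (n N1 N2 : nat).
Local Notation P := (lambda_ring R n N1 N2).
Local Notation AQ := (AQ R n N1 N2).
Local Notation H := (Ccohomology R n N1 N2).

Definition AQ_to_cohomology (a : AQ) : H :=
  cohomology_class (repr (a : {ideal_quot (@AQ_ideal R n N1 N2)}))%:A.

Lemma AQ_class_surj (a : AQ) : exists p, a = AQ_class p.
Proof.
exists (repr (a : {ideal_quot (@AQ_ideal R n N1 N2)})).
by rewrite /AQ_class reprK.
Qed.

Lemma AQ_class_eq (p q : P) :
  AQ_class p = AQ_class q <-> p - q \in @AQ_ideal R n N1 N2.
Proof. by rewrite Quotient.idealrBE; split=> [/eqP|/eqP]. Qed.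

(** The value does not depend on the chosen representative, because constants are exact precisely
    when they lie in the ideal. *)
Lemma AQ_to_cohomologyE (p : P) :
  AQ_to_cohomology (AQ_class p) = cohomology_class p%:A.
Proof.
by apply/cohomology_class_alg_eq/AQ_class_eq; rewrite [LHS]/AQ_class reprK.
Qed.

Lemma AQ_to_cohomology_inj : injective AQ_to_cohomology.
Proof.
move=> a b; have [p ->] := AQ_class_surj a; have [q ->] := AQ_class_surj b.
by rewrite !AQ_to_cohomologyE => /cohomology_class_alg_eq/AQ_class_eq.
Qed.

Lemma AQ_to_cohomology_is_zmod_morphism : zmod_morphism AQ_to_cohomology.
Proof.
move=> a b; have [p ->] := AQ_class_surj a; have [q ->] := AQ_class_surj b.
by rewrite -raddfB !AQ_to_cohomologyE scalerBl raddfB.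
Qed.

Lemma AQ_to_cohomology_is_monoid_morphism : monoid_morphism AQ_to_cohomology.
Proof.
split=> [|a b].
  by rewrite -[1](rmorph1 (@AQ_class R n N1 N2)) AQ_to_cohomologyE scale1r.
have [p ->] := AQ_class_surj a; have [q ->] := AQ_class_surj b.
rewrite -rmorphM !AQ_to_cohomologyE.
have -> : (p * q)%:A = p%:A * q%:A :> koszul_cocycle (@fcoef R n N1 N2).
  by rewrite -scalerAl mul1r scalerA.
exact: cohomology_classM.
Qed.

Lemma AQ_to_cohomology_is_scalable : scalable AQ_to_cohomology.
Proof.
move=> p a; have [q ->] := AQ_class_surj a.
have -> : p *: AQ_class q = AQ_class (p * q) by rewrite rmorphM.
by rewrite !AQ_to_cohomologyE -scalerA -[LHS]/(cohomology_class _) linearZ.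
Qed.

HB.instance Definition _ := GRing.isZmodMorphism.Build
  AQ H AQ_to_cohomology AQ_to_cohomology_is_zmod_morphism.
HB.instance Definition _ := GRing.isMonoidMorphism.Build
  AQ H AQ_to_cohomology AQ_to_cohomology_is_monoid_morphism.
HB.instance Definition _ := GRing.isScalable.Build
  P AQ H _ AQ_to_cohomology AQ_to_cohomology_is_scalable.

End AQToCohomology.

Theorem theorem1 (R : realType) (n N1 N2 : nat) (hn : (3 <= n)%N) :
  (exists phi : {lrmorphism AQ R n N1 N2 -> Ccohomology R n N1 N2},
      injective phi /\
      (forall h : Ccohomology R n N1 N2,
          cohomology_part 0 h <-> exists a, h = phi a)) /\
  (forall j : nat, j != 0%N ->
      forall h : Ccohomology R n N1 N2, cohomology_part j h -> h = 0).
Proof.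
split=> [|j j0 h [z zj ->]].
  exists (@AQ_to_cohomology R n N1 N2); split=> [|h].
    exact: AQ_to_cohomology_inj.
  rewrite cohomology_part0P; split=> [[p ->]|[a ->]].
    by exists (AQ_class p); rewrite -AQ_to_cohomologyE.
  by have [p ->] := AQ_class_surj a; exists p; apply: AQ_to_cohomologyE.
(* A cocycle of nonzero degree has no c-free part, so the exactness result applies to it. *)
have z0 : val z set0 = 0.
  by apply: contraNeq j0 => /zj; rewrite cards0 => <-.
have two_neq0 : 2 != 0 :> R[i] by rewrite pnatr_eq0.
have dz := koszul_cocycleP z.
have [y zy] := quadric_koszul_exact (sqr_i R) two_neq0 hn dz z0.
rewrite -[RHS](raddf0 (@cohomology_class _ _ _)).
by apply/cohomology_classP/koszul_exactP; exists y; rewrite subr0.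
Qed.
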